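(* Let $[D']$ be the problem of minimizing $z(\alpha)=B\alpha+\lambda_1(\alpha)$ over $\alpha\ge0$, where for each node $i$ of the rooted tree $$\lambda_i(\alpha)=\Big(\sum_{j\in\sigma(i)}\lambda_j(\alpha)+w_i-c_i\alpha\Big)^+ .$$ Let $\rho_{\min}=\min_{i\in N} w_i/c_i$, $\rho_{\max}=\max_{i\in N} w_i/c_i$ and $\ell=\rho_{\max}-\rho_{\min}$. Then an optimal value of $\alpha$ for $[D']$ lies on the interval $[\rho_{\min},\rho_{\max}]$, and an optimal solution can be determined within a tolerance of $\epsilon$ in $\mathcal{O}\big(n\log(\ell/\epsilon)\big)$ time by bisection search over this interval.
   Context: The network is a finite rooted tree with node set $N=\{1,\dots,n\}$ and root node $1$; $\sigma(i)$ is the set of immediate successors (children) of node $i$, empty for leaves, and $\pi(i)$ is the parent of $i\ne1$. $(t)^+=\max\{t,0\}$. The weights $w_i\ge0$ are integers, the costs satisfy $c_i>0$, and the budget satisfies $0<B<\sum_{i\in N}c_i$. $[D']$ is the reduced form of the linear programming dual of the fortification problem under the uniform disturbance distribution on $[0,1]$ (that is, $F_Y(y)=y$): maximize $\sum_{i=1}^n w_ix_i$ subject to $\sum_{i=1}^n c_ix_i\le B$, $x_1\le1$, $x_i\le x_{\pi(i)}$ for $i\in N\setminus\{1\}$, and $x_i\ge0$ for $i\in N$. Here $\epsilon>0$ with $\epsilon<\ell$; the tolerance refers to the value of $\alpha$; time counts arithmetic operations and comparisons on real numbers. *)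

(* Defs.v *)
From HB Require Import structures.
From mathcomp Require Import all_boot all_order all_algebra.
From mathcomp Require Import all_classical all_reals all_analysis.

Set Implicit Arguments.
Unset Strict Implicit.
Unset Printing Implicit Defensive.

Import Order.TTheory GRing.Theory Num.Theory.

Local Open Scope ring_scope.

(* The nodes are 0, ..., size.-1 and the root is [ord0] (the paper's node 1).
   [parent] is total; its value at the root is irrelevant, both here and in
   [child] below.  A map from the non-root nodes to nodes is the parent map of
   a tree rooted at [ord0] iff iterating it from any node reaches [ord0]. *)
Record network (R : realType) := Network {
  npred : nat;
  parent : 'I_npred.+1 -> 'I_npred.+1;
  weight : 'I_npred.+1 -> nat;
  cost : 'I_npred.+1 -> R;
  budget : R;
  parent_tree : forall i, fconnect parent i ord0;
  cost_gt0 : forall i, 0 < cost i;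
  budget_gt0 : 0 < budget;
  budget_lt : budget < \sum_i cost i
}.

Definition nnodes (R : realType) (N : network R) : nat := (npred N).+1.
Notation node N := 'I_(npred N).+1.

Section Problem.
Variables (R : realType) (N : network R).

(* [child i] is the set sigma(i). *)
Definition child (i : node N) : {set node N} :=
  [set j | (j != ord0) && (parent j == i)].

(* The recursion defining lambda_i is on the tree; it is unfolded [nnodes N]
   times, which exceeds the height of the tree (see [lambdaE]). *)
Fixpoint lambda_iter (k : nat) (i : node N) (a : R) : R :=
  if k is k'.+1 then
    Num.max (\sum_(j in child i) lambda_iter k' j a
             + (weight i)%:R - cost i * a) 0
  else 0.

Definition lambda (i : node N) (a : R) : R := lambda_iter (nnodes N) i a.

Lemma lambdaE (i : node N) (a : R) :
  lambda i a =
  Num.max (\sum_(j in child i) lambda j a + (weight i)%:R - cost i * a) 0.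
Proof.
pose depth (j : node N) := findex (@parent _ N) j ord0.
have depth_lt j : (depth j < nnodes N)%N.
  apply: leq_trans (findex_max (parent_tree j)) _.
  by rewrite -[leqRHS](card_ord (npred N).+1); apply: max_card.
have depth_child j l : l \in child j -> depth l = (depth j).+1.
  rewrite inE => /andP[l0 /eqP <-].
  by apply: fconnect_findex (parent_tree l) _; rewrite eq_sym.
have stable k : forall j, (nnodes N - depth j <= k)%N ->
    lambda_iter k.+1 j a = lambda_iter k j a.
  elim: k => [|k IHk] j jk.
    by move: jk; rewrite leqn0 subn_eq0 leqNgt depth_lt.
  congr (Num.max (_ + _ - _) _); apply: eq_bigr => l /depth_child dl.
  apply: IHk; rewrite dl subnS.
  by case: (nnodes N - depth j)%N jk.
rewrite /lambda [in LHS]/=; congr (Num.max (_ + _ - _) _).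
apply: eq_bigr => l /depth_child dl.
by rewrite stable // dl subSS leq_subr.
Qed.

Definition z (a : R) : R := budget N * a + lambda ord0 a.

Definition optimal (a : R) : Prop := 0 <= a /\ forall b, 0 <= b -> z a <= z b.

Definition rho (i : node N) : R := (weight i)%:R / cost i.
Definition rho_min : R := \big[Num.min/rho ord0]_i rho i.
Definition rho_max : R := \big[Num.max/rho ord0]_i rho i.
Definition ell : R := rho_max - rho_min.

End Problem.

(* A real random access machine.  The memory consists of arrays of natural
   numbers and arrays of reals, all named and indexed by natural numbers;
   entry 0 of an array serves as a scalar variable.  Reals can be loaded from
   numerals, copied, combined by the four operations and compared; they never
   act as indices and there is no rounding. *)
Inductive nexp :=
| NConst of nat
| NGet of nat & nexp
| NAdd of nexp & nexp
| NSub of nexp & nexp.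

Definition rloc := (nat * nexp)%type.

Inductive rop := RAdd | RSub | RMul | RDiv.

Inductive test :=
| NLt of nexp & nexp
| RLt of rloc & rloc.

Inductive cmd :=
| Skip
| Seq of cmd & cmd
| NSet of nat & nexp & nexp
| RConst of rloc & nat
| RCopy of rloc & rloc
| RCalc of rloc & rop & rloc & rloc
| If of test & cmd & cmd
| While of test & cmd.

Record state (R : realType) := State {
  nmem : nat -> nat -> nat;
  rmem : nat -> nat -> R
}.

Section Semantics.
Variable R : realType.
Implicit Types s : state R.

Definition update (T : Type) (m : nat -> nat -> T) (x i : nat) (v : T) :=
  fun y j => if (y == x) && (j == i) then v else m y j.

Fixpoint neval s (e : nexp) : nat :=
  match e with
  | NConst k => k
  | NGet x e1 => nmem s x (neval s e1)
  | NAdd e1 e2 => neval s e1 + neval s e2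
  | NSub e1 e2 => neval s e1 - neval s e2
  end%N.

Definition rget s (l : rloc) : R := rmem s l.1 (neval s l.2).

Definition nset s (x i v : nat) : state R :=
  State (update (nmem s) x i v) (rmem s).

Definition rset s (l : rloc) (v : R) : state R :=
  State (nmem s) (update (rmem s) l.1 (neval s l.2) v).

Definition rop_eval (o : rop) (u v : R) : R :=
  match o with
  | RAdd => u + v
  | RSub => u - v
  | RMul => u * v
  | RDiv => u / v
  end.

Definition test_eval s (b : test) : bool :=
  match b with
  | NLt e1 e2 => (neval s e1 < neval s e2)%N
  | RLt l1 l2 => rget s l1 < rget s l2
  end.

Definition test_time (b : test) : nat := if b is RLt _ _ then 1 else 0.

(* [exec p s t s']: run from [s], the program [p] halts in [s'] after [t]
   arithmetic operations and comparisons on reals. *)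
Inductive exec : cmd -> state R -> nat -> state R -> Prop :=
| ESkip s : exec Skip s 0 s
| ESeq p q s t s1 t1 s2 :
    exec p s t s1 -> exec q s1 t1 s2 -> exec (Seq p q) s (t + t1) s2
| ENSet x i e s : exec (NSet x i e) s 0 (nset s x (neval s i) (neval s e))
| ERConst l k s : exec (RConst l k) s 0 (rset s l k%:R)
| ERCopy l l1 s : exec (RCopy l l1) s 0 (rset s l (rget s l1))
| ERCalc l o l1 l2 s :
    exec (RCalc l o l1 l2) s 1 (rset s l (rop_eval o (rget s l1) (rget s l2)))
| EIf b p q s t s1 :
    exec (if test_eval s b then p else q) s t s1 ->
    exec (If b p q) s (test_time b + t) s1
| EWhileF b p s : ~~ test_eval s b -> exec (While b p) s (test_time b) s
| EWhileT b p s t s1 t1 s2 :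
    test_eval s b -> exec p s t s1 -> exec (While b p) s1 t1 s2 ->
    exec (While b p) s (test_time b + t + t1) s2.

End Semantics.

(* Array names.  The instance is in [nSize] (entry 0), [nParent], [rW], [rC],
   [rB] and [rEps]; [nAnswer] is the verdict of a bisection step; names that
   are not listed are free for use. *)
Definition rW := 0%N.
Definition rC := 1%N.
Definition rB := 2%N.
Definition rEps := 3%N.
Definition rLo := 4%N.
Definition rHi := 5%N.
Definition rMid := 6%N.
Definition rWidth := 7%N.
Definition rTmp := 8%N.

Definition nSize := 0%N.
Definition nParent := 1%N.
Definition nCount := 2%N.
Definition nAnswer := 3%N.

Definition input (R : realType) (N : network R) (eps : R) : state R :=
  let tabulate (T : Type) (d : T) (f : node N -> T) (i : nat) : T :=
    if insub i is Some j then f j else d in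
  State
    (fun x i =>
       if x == nSize then if i == 0%N then nnodes N else 0%N
       else if x == nParent then tabulate nat 0%N (fun j => parent j : nat) i
       else 0%N)
    (fun x i =>
       if x == rW then tabulate R 0 (fun j => (weight j)%:R) i
       else if x == rC then tabulate R 0 (@cost R N) i
       else if x == rB then if i == 0%N then budget N else 0
       else if x == rEps then if i == 0%N then eps else 0
       else 0).

Definition nvar (x : nat) : nexp := NGet x (NConst 0).
Definition rvar (x : nat) : rloc := (x, NConst 0).

Definition seqs (ps : seq cmd) : cmd := foldr Seq Skip ps.

(* lo := min_i w_i / c_i and hi := max_i w_i / c_i *)
Definition endpoints : cmd :=
  let ratio := RCalc (rvar rTmp) RDiv (rW, nvar nCount) (rC, nvar nCount) in
  seqs [::
    NSet nCount (NConst 0) (NConst 0);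
    ratio;
    RCopy (rvar rLo) (rvar rTmp);
    RCopy (rvar rHi) (rvar rTmp);
    While (NLt (nvar nCount) (nvar nSize)) (seqs [::
      ratio;
      If (RLt (rvar rTmp) (rvar rLo)) (RCopy (rvar rLo) (rvar rTmp)) Skip;
      If (RLt (rvar rHi) (rvar rTmp)) (RCopy (rvar rHi) (rvar rTmp)) Skip;
      NSet nCount (NConst 0) (NAdd (nvar nCount) (NConst 1))])].

(* Bisection search over [rho_min, rho_max].  The program [side] decides which
   half of the current interval is kept: the left one if it sets the answer to
   a positive number, the right one otherwise. *)
Definition bisection (side : cmd) : cmd :=
  let width := RCalc (rvar rWidth) RSub (rvar rHi) (rvar rLo) in
  seqs [::
    endpoints;
    width;
    While (RLt (rvar rEps) (rvar rWidth)) (seqs [::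
      RCalc (rvar rMid) RAdd (rvar rLo) (rvar rHi);
      RConst (rvar rTmp) 2;
      RCalc (rvar rMid) RDiv (rvar rMid) (rvar rTmp);
      side;
      If (NLt (NConst 0) (nvar nAnswer))
        (RCopy (rvar rHi) (rvar rMid))
        (RCopy (rvar rLo) (rvar rMid));
      width])].

Fixpoint rwrites (p : cmd) : seq nat :=
  match p with
  | Skip | NSet _ _ _ => [::]
  | RConst l _ | RCopy l _ | RCalc l _ _ _ => [:: l.1]
  | Seq p1 p2 | If _ p1 p2 => rwrites p1 ++ rwrites p2
  | While _ p1 => rwrites p1
  end.

(* A decision program for [bisection] may not tamper with the interval, the
   query point or the tolerance. *)
Definition admissible (side : cmd) : Prop :=
  {in [:: rLo; rHi; rMid; rEps], forall x, x \notin rwrites side}.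

(* The approximate solution that the bisection leaves in the memory. *)
Definition output (R : realType) (s : state R) : R := rget s (rvar rLo).

(* Main.v *)
(** Below [rho_min] no positive part is active, so [z] is affine with slope
    [B - sum c_i < 0]; above [rho_max] all [lambda_i] vanish and [z] has slope
    [B > 0].  By continuity a minimizer lies in between.  The recursion for
    [lambda] propagates subgradients from the leaves to the root: when the
    positive part at a node is active, the node passes its value and the sum of
    its children's slopes minus [c_i] to its parent, and otherwise nothing.  One
    pass over the tree, with O(n) real operations, thus yields a subgradient of
    [z] at the midpoint, whose sign tells which half contains a minimizer. *)

Require Import Defs.
From mathcomp Require Import all_boot all_order all_algebra.
From mathcomp Require Import all_classical all_reals all_analysis.
From mathcomp Require Import zify ring lra.

Import Order.TTheory GRing.Theory Num.Theory.
Import numFieldNormedType.Exports.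
Local Open Scope ring_scope.

Set Implicit Arguments.
Unset Strict Implicit.
Unset Printing Implicit Defensive.

(** * The objective and its minimizers *)

Section ReducedDual.
Variables (R : realType) (N : network R).
Implicit Types (i j : node N) (a b : R).

(** Every non-root node is a child of exactly one node, its parent. *)
Lemma sum_child (f : node N -> R) :
  \sum_i \sum_(j in child i) f j = \sum_(j | j != ord0) f j.
Proof.
rewrite (exchange_big_dep (fun j => j != ord0)) /=; last first.
  by move=> i j _; rewrite inE => /andP[].
apply: eq_bigr => j j0; rewrite (big_pred1 (parent j)) // => i.
by rewrite inE j0 eq_sym.
Qed.

Lemma lambda_ge0 i a : 0 <= lambda i a.
Proof. by rewrite lambdaE le_max lexx orbT. Qed.

Lemma rho_min_le i : rho_min N <= rho i.
Proof. exact: bigmin_le. Qed.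

Lemma rho_max_ge i : rho i <= rho_max N.
Proof. exact: le_bigmax. Qed.

Lemma rho_min_ge0 : 0 <= rho_min N.
Proof.
by apply: le_bigmin => [|i _]; apply: divr_ge0; rewrite ?ler0n // ltW ?cost_gt0.
Qed.

Lemma rho_min_le_max : rho_min N <= rho_max N.
Proof. exact: le_trans (rho_min_le ord0) (rho_max_ge ord0). Qed.

(** By induction on the unfolding depth: once the children contribute 0, the argument of the
    positive part is [w_i - c_i a <= 0]. *)
Lemma lambda_eq0 i a : rho_max N <= a -> lambda i a = 0.
Proof.
move=> aM; rewrite /lambda; move: (nnodes N) => k.
elim: k i => // k IHk i /=.
rewrite big1 ?add0r => [|j _]; last exact: IHk.
apply/max_idPr; rewrite subr_le0 mulrC -ler_pdivrMr ?cost_gt0 //.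
exact: le_trans (rho_max_ge i) aM.
Qed.

(* Below rho_min no positive part is active; summing the recursion over all
   nodes leaves only lambda at the root. *)
Lemma lambda_root_affine a : a <= rho_min N ->
  lambda (ord0 : node N) a = \sum_(i : node N) ((weight i)%:R - cost i * a).
Proof.
move=> am; pose s := \sum_(j : node N | j != ord0) lambda j a.
suff: \sum_(i : node N) lambda i a =
    s + \sum_(i : node N) ((weight i)%:R - cost i * a).
  by rewrite (bigD1 ord0) //= addrC => /addrI.
rewrite /s -sum_child -big_split /=; apply: eq_bigr => i _.
rewrite [LHS]lambdaE addrA; apply/max_idPl; rewrite -addrA addr_ge0 //.
  by apply: sumr_ge0 => j _; exact: lambda_ge0.
rewrite subr_ge0 mulrC -ler_pdivlMr ?cost_gt0 //.
exact: le_trans am (rho_min_le i).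
Qed.

Lemma continuous_lambda i : continuous (lambda i).
Proof.
rewrite /lambda; move: (nnodes N) => k.
elim: k i => [|k IHk] i a /=; first exact: cvg_cst.
apply: (@continuous_max R R (fun b => _) (fun=> 0)); last exact: cvg_cst.
apply: continuousB; last by apply: continuousM; [exact: cvg_cst|exact: cvg_id].
apply: continuousD; last exact: cvg_cst.
apply: cvg_big => [|j _]; [exact: add_continuous|exact: IHk].
Qed.

Lemma continuous_z : continuous (z N).
Proof.
move=> a; apply: continuousD; last exact: continuous_lambda.
by apply: continuousM; [exact: cvg_cst|exact: cvg_id].
Qed.

Lemma z_rho_min_le a : a <= rho_min N -> z N (rho_min N) <= z N a.
Proof.
move=> am; rewrite /z !lambda_root_affine // !sumrB -!mulr_suml.
by have := budget_lt N; nra.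
Qed.

Lemma z_rho_max_le a : rho_max N <= a -> z N (rho_max N) <= z N a.
Proof.
by move=> aM; rewrite /z !lambda_eq0 // !addr0 ler_pM2l ?budget_gt0.
Qed.

(** The extreme value theorem gives a minimizer on the compact interval; outside it, [z] is bounded
    below by its value at the nearer endpoint. *)
Lemma optimal_exists : exists a, optimal N a /\ rho_min N <= a <= rho_max N.
Proof.
have [|a] := @EVT_min R (z N) _ _ rho_min_le_max.
  exact/continuous_subspaceT/continuous_z.
rewrite in_itv /= => aI a_min; exists a; split=> //.
have [ma aM] := andP aI; split=> [|b b0]; first exact: le_trans rho_min_ge0 ma.
have [bm|mb] := leP b (rho_min N).
  apply: le_trans (z_rho_min_le bm); apply: a_min.
  by rewrite in_itv /= lexx rho_min_le_max.
have [Mb|bM] := leP (rho_max N) b.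
  apply: le_trans (z_rho_max_le Mb); apply: a_min.
  by rewrite in_itv /= lexx rho_min_le_max.
by apply: a_min; rewrite in_itv /= !ltW.
Qed.

(** If the known minimizer [a] lies in the discarded half, then [g * (a - m) >= 0], so the
    subgradient inequality gives [z m <= z a]: the midpoint is itself optimal, and it belongs to the
    half that is kept. *)
Lemma optimal_halving (lo hi m g : R) :
    0 <= m -> (forall b, z N m + g * (b - m) <= z N b) ->
    (exists a, optimal N a /\ lo <= a <= hi) -> lo <= m <= hi ->
  exists a, optimal N a /\ (if 0 <= g then lo <= a <= m else m <= a <= hi).
Proof.
move=> m0 sub [a [[a0 aopt] /andP[la ah]]] /andP[lm mh].
have m_opt : z N m <= z N a -> optimal N m.
  by move=> ma; split=> // b b0; apply: le_trans ma (aopt _ b0).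
have := sub a; have [g0|g0] := leP 0 g.
- have [am|am] := leP a m; first by exists a; rewrite la am.
  move=> ?; exists m; rewrite lm lexx; split=> //; apply: m_opt; nra.
- have [am|am] := leP m a; first by exists a; rewrite ah am.
  move=> ?; exists m; rewrite mh lexx; split=> //; apply: m_opt; nra.
Qed.

End ReducedDual.

(** * Total correctness of programs *)

Section WeakestPrecondition.
Variable R : realType.
Implicit Types (p q : cmd) (b : test) (s : state R) (t : nat).
Implicit Types Q : nat -> state R -> Prop.

(* Loop-free code is executed symbolically by simplification; loops are left
   to [wp_while]. *)
Fixpoint wp p s Q : Prop :=
  match p with
  | Skip => Q 0%N s
  | Seq p1 p2 => wp p1 s (fun t s1 => wp p2 s1 (fun t1 => Q (t + t1)%N))
  | NSet x i e => Q 0%N (nset s x (neval s i) (neval s e))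
  | RConst l k => Q 0%N (rset s l k%:R)
  | RCopy l l1 => Q 0%N (rset s l (rget s l1))
  | RCalc l o l1 l2 =>
      Q 1%N (rset s l (rop_eval o (rget s l1) (rget s l2)))
  | If b p1 p2 =>
      if test_eval s b then wp p1 s (fun t => Q (test_time b + t)%N)
      else wp p2 s (fun t => Q (test_time b + t)%N)
  | While b p1 => exists t s1, exec (While b p1) s t s1 /\ Q t s1
  end.

Lemma wp_exec p s Q : wp p s Q -> exists t s1, exec p s t s1 /\ Q t s1.
Proof.
elim: p s Q => //=; try by [move=> *; do 2 eexists; split; [constructor|eassumption]].
- move=> p IHp q IHq s Q /IHp[t [s1 [ps /IHq[t1 [s2 [qs Qs]]]]]].
  by exists (t + t1)%N, s2; split=> //; apply: ESeq ps qs.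
- move=> b p IHp q IHq s Q.
  case: ifPn => [bs /IHp|bs /IHq] [t [s1 [ps Qs]]];
    exists (test_time b + t)%N, s1; split=> //; apply: EIf.
    by rewrite bs.
  by rewrite (negbTE bs).
Qed.

(** The rule of consequence, with the actual run available when the postcondition is weakened;
    [wp_frame] draws its frame facts from that run. *)
Lemma wp_exec_mono p s Q Q' : (forall t s1, exec p s t s1 -> Q t s1 -> Q' t s1) ->
  wp p s Q -> wp p s Q'.
Proof.
elim: p s Q Q' => /=; try by
  [move=> *; match goal with H : _ |- _ => apply: H => //; constructor end].
- move=> p IHp q IHq s Q Q' QQ'; apply: IHp => t s1 ps; apply: IHq => t1 s2 qs.
  by apply: QQ'; apply: ESeq ps qs.
- move=> b p IHp q IHq s Q Q' QQ'; case: ifPn => bs.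
    by apply: IHp => t s1 ps; apply: QQ'; apply: EIf; rewrite bs.
  by apply: IHq => t s1 ps; apply: QQ'; apply: EIf; rewrite (negbTE bs).
- by move=> b p _ s Q Q' QQ' [t [s1 [ex Qs]]]; exists t, s1; split; auto.
Qed.

Fixpoint nwrites p : seq nat :=
  match p with
  | NSet x _ _ => [:: x]
  | Skip | RConst _ _ | RCopy _ _ | RCalc _ _ _ _ => [::]
  | Seq p1 p2 | If _ p1 p2 => nwrites p1 ++ nwrites p2
  | While _ p1 => nwrites p1
  end.

(** Indices are computed at run time, so the granularity is the array name: one write to an array
    releases all its entries. *)
Definition frame p s s1 : Prop :=
  (forall x, x \notin nwrites p -> nmem s1 x = nmem s x) /\
  (forall x, x \notin rwrites p -> rmem s1 x = rmem s x).

Lemma update_neq (T : Type) (m : nat -> nat -> T) x i v y :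
  y != x -> update m x i v y = m y.
Proof. by rewrite /update => /negbTE ->. Qed.

Lemma exec_frame p s t s1 : exec p s t s1 -> frame p s s1.
Proof.
elim=> {p s t s1}; try by [].
- move=> p q s t s1 t1 s2 _ [np rp] _ [nq rq]; split=> x /=;
    rewrite mem_cat => /norP[xp xq].
    by rewrite nq ?np.
  by rewrite rq ?rp.
- move=> x i e s; split=> y /=; rewrite // inE => yx.
  exact: update_neq.
- move=> l k s; split=> y /=; rewrite // inE => yx.
  exact: update_neq.
- move=> l l1 s; split=> y /=; rewrite // inE => yx.
  exact: update_neq.
- move=> l o l1 l2 s; split=> y /=; rewrite // inE => yx.
  exact: update_neq.
- move=> b p q s t s1 _ [np rp]; split=> x /=; rewrite mem_cat => /norP[xp xq].
    by apply: np; case: ifP.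
  by apply: rp; case: ifP.
- move=> b p s t s1 t1 s2 _ _ [np rp] _ [nw rw]; split=> x xp.
    by rewrite nw ?np.
  by rewrite rw ?rp.
Qed.

Lemma frame_trans p s s1 s2 : frame p s s1 -> frame p s1 s2 -> frame p s s2.
Proof.
move=> [np rp] [np' rp']; split=> x xp; first by rewrite np' ?np.
by rewrite rp' ?rp.
Qed.

Lemma wp_frame p s Q Q' : wp p s Q ->
  (forall t s1, frame p s s1 -> Q t s1 -> Q' t s1) -> wp p s Q'.
Proof.
by move=> ps QQ'; apply: wp_exec_mono ps => t s1 /exec_frame; apply: QQ'.
Qed.

Lemma wp_seq p q s Q :
  wp p s (fun t s1 => wp q s1 (fun t1 => Q (t + t1)%N)) -> wp (Seq p q) s Q.
Proof. by []. Qed.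

(* [I m t s1]: after time [t] the loop is in state [s1] and at most [m] rounds
   are left. *)
Lemma wp_while b p (I : nat -> nat -> state R -> Prop) Q s :
    (forall m t s1, frame p s s1 -> I m t s1 -> ~~ test_eval s1 b ->
       Q (t + test_time b)%N s1) ->
    (forall m t s1, frame p s s1 -> I m t s1 -> test_eval s1 b -> (0 < m)%N /\
       wp p s1 (fun t1 => I m.-1 (t + (test_time b + t1))%N)) ->
  forall m, I m 0%N s -> wp (While b p) s Q.
Proof.
move=> stop step m.
suff gen m' t s1 : frame p s s1 -> I m' t s1 ->
    wp (While b p) s1 (fun t1 => Q (t + t1)%N) by apply: gen.
elim: m' t s1 => [|m' IHm] t s1 fr Is; have [bs|bs] := boolP (test_eval s1 b).
- by have [] := step _ _ _ fr Is bs.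
- exists (test_time b), s1; split; [exact: EWhileF|exact: stop fr Is bs].
- have [_ /wp_exec[t1 [s2 [ps Is2]]]] := step _ _ _ fr Is bs.
  have [t2 [s3 [ws Qs]]] := IHm _ _ (frame_trans fr (exec_frame ps)) Is2.
  exists (test_time b + t1 + t2)%N, s3; split; first exact: EWhileT ps ws.
  by rewrite addnA.
- exists (test_time b), s1; split; [exact: EWhileF|exact: stop fr Is bs].
Qed.

(** The rule for loops that count [x] up to the number of nodes. The loop test compares natural
    numbers and therefore adds no time. *)
Lemma wp_count x p n (I : nat -> nat -> state R -> Prop) Q s k :
    nSize \notin nwrites p -> nmem s nSize 0%N = n -> (k <= n)%N ->
    nmem s x 0%N = k -> I k 0%N s ->
    (forall i t s1, (i < n)%N -> frame p s s1 -> nmem s1 x 0%N = i -> I i t s1 ->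
       wp p s1 (fun t1 s2 => nmem s2 x 0%N = i.+1 /\ I i.+1 (t + t1)%N s2)) ->
    (forall t s1, frame p s s1 -> I n t s1 -> Q t s1) ->
  wp (While (NLt (nvar x) (nvar nSize)) p) s Q.
Proof.
move=> sp sn kn sx Ik step stop.
(* [wp_while] counts the remaining rounds down, whereas [I] is indexed by the counter; [m] remaining
   rounds correspond to index [n - m]. *)
pose J m t s1 := [/\ (m <= n)%N, nmem s1 x 0%N = (n - m)%N & I (n - m)%N t s1].
have size_eq s1 : frame p s s1 -> nmem s1 nSize 0%N = n.
  by move=> [np _]; rewrite np.
apply: (@wp_while _ _ J _ _ _ _ (n - k)%N) => /=.
- move=> m t s1 fr [mn xm Im]; rewrite /= (size_eq _ fr) xm -leqNgt addn0.
  case: m mn {xm} Im => [|m] mn Im.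
    by move=> _; rewrite subn0 in Im; apply: stop.
  by rewrite leqNgt ltn_subrL /= (leq_trans _ mn).
- move=> m t s1 fr [mn xm Im]; rewrite /= (size_eq _ fr) xm.
  case: m mn xm Im => [|m] mn xm Im; first by rewrite subn0 ltnn.
  move=> lt; split=> //; apply: wp_frame (step _ _ _ lt fr xm Im) _.
  move=> t1 s2 _ [x2 I2]; have e : (n - m = (n - m.+1).+1)%N by rewrite -subSn.
  by split; rewrite ?e // ltnW.
- by rewrite /J subKn // leq_subr.
Qed.

End WeakestPrecondition.

(** * Subgradients of partial sums *)

Section PartialSums.
Variables (R : realType) (N : network R).
Implicit Types (i j : node N) (a b : R) (P : {set node N}).

(** * Depths and the order in which nodes are treated *)

Definition depth i : nat := findex (@parent R N) i ord0.

Lemma depth_lt i : (depth i < nnodes N)%N.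
Proof.
apply: leq_trans (findex_max (parent_tree i)) _.
by rewrite -[leqRHS](card_ord (npred N).+1); apply: max_card.
Qed.

Lemma depth_eq0 i : (depth i == 0%N) = (i == ord0).
Proof. by rewrite /depth findex_eq0. Qed.

Lemma depth_parent i : i != ord0 -> depth i = (depth (parent i)).+1.
Proof.
by move=> i0; apply: fconnect_findex (parent_tree i) _; rewrite eq_sym.
Qed.

Lemma depth_child i j : j \in child i -> depth j = (depth i).+1.
Proof. by rewrite inE => /andP[j0 /eqP <-]; apply: depth_parent. Qed.

(* The nodes treated before node [m] is reached on level [k], where level [k]
   is at depth [nnodes N - k]. *)
Definition finished (k m : nat) : {set node N} :=
  [set j | (nnodes N < depth j + k + (j < m))%N].

Lemma finished_first : finished 1 0 = finset.set0.
Proof. by apply/setP => j; rewrite !inE ltn0 addn0 addn1 ltnNge depth_lt. Qed.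

Lemma finished_next k : finished k (nnodes N) = finished k.+1 0.
Proof. by apply/setP => j; rewrite !inE ltn_ord ltn0 addn0 addn1 addnS. Qed.

Lemma finished_last : finished (nnodes N) 0 = [set~ ord0].
Proof.
apply/setP => j; rewrite !inE -depth_eq0 ltn0 addn0 -lt0n.
by rewrite -{1}[nnodes N]add0n ltn_add2r.
Qed.

Lemma finished_skip k i : (depth i + k != nnodes N)%N ->
  finished k i.+1 = finished k i.
Proof.
move=> ik; apply/setP => j; rewrite !inE ltnS.
have [->|ji] := eqVneq j i; last first.
  by rewrite [(j < i)%N]ltn_neqAle (ji : (j != i :> nat)).
by rewrite leqnn ltnn addn0 addn1 ltnS leq_eqVlt eq_sym (negbTE ik).
Qed.

Lemma finished_notin k i : (depth i + k = nnodes N)%N -> i \notin finished k i.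
Proof. by move=> ik; rewrite inE ltnn addn0 ik ltnn. Qed.

Lemma finished_step k i : (depth i + k = nnodes N)%N ->
  finished k i.+1 = i |: finished k i.
Proof.
move=> ik; apply/setP => j; rewrite !inE ltnS.
have [->|ji] := eqVneq j i; first by rewrite leqnn addn1 ik ltnSn.
by rewrite [(j < i)%N]ltn_neqAle (ji : (j != i :> nat)).
Qed.

(** Children lie one level deeper than [i], and that level is complete when level [k] begins. *)
Lemma child_finished k i : (depth i + k = nnodes N)%N ->
  child i \subset finished k i.
Proof.
move=> ik; apply/fintype.subsetP => j /depth_child dj.
by rewrite inE dj !addSn ik ltnS leq_addr.
Qed.

(* The argument of the positive part in the recursion, with only the children
   in [P] taken into account. *)
Definition partial P i a : R :=
  \sum_(j in child i :&: P) lambda j a + (weight i)%:R - cost i * a.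

Lemma lambda_partial P i a :
  child i \subset P -> lambda i a = Num.max (partial P i a) 0.
Proof. by rewrite lambdaE /partial => /finset.setIidPl ->. Qed.

Lemma partial0 i a : partial finset.set0 i a = (weight i)%:R - cost i * a.
Proof. by rewrite /partial finset.setI0 big_set0 add0r. Qed.

Lemma partial_add P i j a : i != ord0 -> i \notin P ->
  partial (i |: P) j a = partial P j a + (if j == parent i then lambda i a else 0).
Proof.
move=> i0 iP; rewrite /partial; case: eqVneq => [->|ji].
  have ->: child (parent i) :&: (i |: P) = i |: (child (parent i) :&: P).
    apply/setP => l; rewrite !inE; case: (eqVneq l i) => //= ->.
    by rewrite i0 eqxx.
  by rewrite big_setU1 ?inE ?(negbTE iP) ?andbF //=; ring.
rewrite addr0; congr (_ + _ - _); apply: eq_bigl => l; rewrite !inE.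
by case: (eqVneq l i) => //= ->; rewrite i0 eq_sym (negbTE ji) (negbTE iP).
Qed.

(** [G j] is a subgradient of [partial P j] at [a]. The functions [L] and [G] model the arrays
    [rPre] and [rSlope]. *)
Definition tracks a P (L G : node N -> R) : Prop :=
  forall j, L j = partial P j a /\
    forall b, partial P j a + G j * (b - a) <= partial P j b.

Lemma tracks_ext a P L G L' G' : L =1 L' -> G =1 G' ->
  tracks a P L G -> tracks a P L' G'.
Proof. by move=> LL' GG' acc j; rewrite -LL' -GG'. Qed.

Lemma tracks0 a L G :
    (forall j, L j = (weight j)%:R - cost j * a) -> (forall j, G j = - cost j) ->
  tracks a finset.set0 L G.
Proof.
move=> Lj Gj j; rewrite Lj Gj partial0; split=> // b; rewrite partial0; lra.
Qed.

(** [lambda i] is the maximum of [partial P i] and 0. A subgradient of whichever of the two attains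
    the maximum at [a] is one of the maximum. *)
Lemma lambda_subgradient a P L G i : child i \subset P -> tracks a P L G ->
  forall b, lambda i a + (if 0 < L i then G i else 0) * (b - a) <= lambda i b.
Proof.
move=> /lambda_partial lam /(_ i)[-> sub] b; rewrite !lam.
have [pos|neg] := ltP 0; last by rewrite mul0r addr0 le_max lexx orbT.
by rewrite le_max sub.
Qed.

(** Treating [i] adds [lambda i] to the argument at its parent alone. If [L i <= 0], this summand
    vanishes at [a] and has subgradient 0 there, so leaving the parent unchanged is correct. *)
Lemma tracks_push a P L G i : i != ord0 -> i \notin P -> child i \subset P ->
    tracks a P L G ->
  tracks a (i |: P)
    (fun j => if (0 < L i) && (j == parent i) then L j + L i else L j)
    (fun j => if (0 < L i) && (j == parent i) then G j + G i else G j).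
Proof.
move=> i0 iP iC acc j; have [Lj Gj] := acc j.
have sub := lambda_subgradient iC acc; have [Li _] := acc i.
have lam := lambda_partial a iC; rewrite -Li in lam.
rewrite partial_add //; case: (eqVneq j (parent i)) => ji; last first.
  by rewrite andbF addr0; split=> // b; rewrite partial_add // (negbTE ji) addr0.
rewrite andbT; split=> [|b].
  by rewrite lam Lj; case: ltP => _; rewrite ?addr0.
rewrite partial_add // ji eqxx -ji; have := sub b; have := Gj b.
by case: ifP => _; lra.
Qed.

End PartialSums.

(** * The decision program *)

Definition nLevel := 4%N.
Definition nNode := 5%N.
Definition nWalk := 6%N.
Definition nHeight := 7%N.
Definition rPre := 9%N.
Definition rSlope := 10%N.
Definition rZero := 11%N.

Definition incr (x : nat) : cmd :=
  NSet x (NConst 0) (NAdd (nvar x) (NConst 1)).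

Definition init_node : cmd :=
  seqs [::
    RCalc (rvar rTmp) RMul (rC, nvar nNode) (rvar rMid);
    RCalc (rPre, nvar nNode) RSub (rW, nvar nNode) (rvar rTmp);
    RCalc (rSlope, nvar nNode) RSub (rvar rZero) (rC, nvar nNode);
    incr nNode].

Definition climb : cmd :=
  seqs [::
    incr nHeight;
    NSet nWalk (NConst 0) (NGet nParent (nvar nWalk))].

Definition push : cmd :=
  let to_parent x :=
    RCalc (x, NGet nParent (nvar nNode)) RAdd
          (x, NGet nParent (nvar nNode)) (x, nvar nNode) in
  If (RLt (rvar rZero) (rPre, nvar nNode))
    (Seq (to_parent rSlope) (to_parent rPre)) Skip.

(** [nHeight] starts at the level, so after the climb it is depth plus level, which equals the
    number of nodes exactly on the current level. The two strict tests together express this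
    equality. *)
Definition visit_node : cmd :=
  seqs [::
    NSet nWalk (NConst 0) (nvar nNode);
    NSet nHeight (NConst 0) (nvar nLevel);
    While (NLt (NConst 0) (nvar nWalk)) climb;
    If (NLt (nvar nHeight) (nvar nSize)) Skip
      (If (NLt (nvar nSize) (nvar nHeight)) Skip push);
    incr nNode].

Definition visit_level : cmd :=
  seqs [::
    NSet nNode (NConst 0) (NConst 0);
    While (NLt (nvar nNode) (nvar nSize)) visit_node;
    incr nLevel].

(** A subgradient of [z] is the budget, plus the root's slope if the positive part at the root is
    active. Slope 0 counts as a vote for the left half. *)
Definition verdict : cmd :=
  seqs [::
    NSet nAnswer (NConst 0) (NConst 1);
    RCopy (rvar rTmp) (rvar rB);
    If (RLt (rvar rZero) (rvar rPre))
      (RCalc (rvar rTmp) RAdd (rvar rTmp) (rvar rSlope)) Skip;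
    If (RLt (rvar rTmp) (rvar rZero))
      (NSet nAnswer (NConst 0) (NConst 0)) Skip].

(* Natural-number operations are free, so the nodes can be visited from the
   deepest level upwards by recomputing depths; level [k] is at depth
   [nnodes N - k] and the root is never visited. *)
Definition slope_sign : cmd :=
  seqs [::
    RConst (rvar rZero) 0;
    NSet nNode (NConst 0) (NConst 0);
    While (NLt (nvar nNode) (nvar nSize)) init_node;
    NSet nLevel (NConst 0) (NConst 1);
    While (NLt (nvar nLevel) (nvar nSize)) visit_level;
    verdict].

(** * Correctness and running time of the decision program *)

Section SlopeSign.
Variables (R : realType) (N : network R) (eps : R).
Implicit Types (s : state R) (i j : node N).

(** Only the instance is fixed; the working arrays are arbitrary, so the decision program can be
    rerun on whatever earlier rounds left behind. *)
Definition loaded s : Prop :=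
  {in [:: nSize; nParent], nmem s =1 nmem (input N eps)} /\
  {in [:: rW; rC; rB; rEps], rmem s =1 rmem (input N eps)}.

Definition keeps_input p : bool :=
  all (fun x => x \notin nwrites p) [:: nSize; nParent] &&
  all (fun x => x \notin rwrites p) [:: rW; rC; rB; rEps].

Lemma loaded_frame p s s1 : keeps_input p -> loaded s -> frame p s s1 -> loaded s1.
Proof.
move=> /andP[/allP np /allP rp] [ns rs] [nf rf]; split=> x xin.
  by rewrite nf ?ns ?np.
by rewrite rf ?rs ?rp.
Qed.

Lemma loaded_nset s x m v : x \notin [:: nSize; nParent] ->
  loaded s -> loaded (nset s x m v).
Proof.
move=> xin [ns rs]; split=> // y yin; rewrite /= update_neq ?ns //.
by apply: contraNneq xin => <-.
Qed.

Lemma loaded_rset s l v : l.1 \notin [:: rW; rC; rB; rEps] ->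
  loaded s -> loaded (rset s l v).
Proof.
move=> xin [ns rs]; split=> // y yin; rewrite /= update_neq ?rs //.
by apply: contraNneq xin => <-.
Qed.

Lemma loaded_size s : loaded s -> nmem s nSize 0%N = nnodes N.
Proof. by move=> [-> //]. Qed.

Lemma loaded_parent s j : loaded s -> nmem s nParent j = parent j.
Proof. by move=> [-> // _]; rewrite /= valK. Qed.

Lemma loaded_weight s j : loaded s -> rmem s rW j = (weight j)%:R.
Proof. by move=> [_ ->//]; rewrite /= valK. Qed.

Lemma loaded_cost s j : loaded s -> rmem s rC j = cost j.
Proof. by move=> [_ ->//]; rewrite /= valK. Qed.

Lemma loaded_budget s : loaded s -> rmem s rB 0%N = budget N.
Proof. by move=> [_ ->]. Qed.

Lemma loaded_eps s : loaded s -> rmem s rEps 0%N = eps.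
Proof. by move=> [_ ->]. Qed.

Definition row s x : node N -> R := fun j => rmem s x j.

(** Each step trades one unit of depth for one unit of [nHeight], so their sum is invariant. The
    root has index 0, hence the loop stops exactly there. *)
Lemma wp_climb s i k Q : loaded s ->
    nmem s nWalk 0%N = i -> nmem s nHeight 0%N = k ->
    (forall s1, frame climb s s1 -> nmem s1 nHeight 0%N = (depth i + k)%N ->
       Q 0%N s1) ->
  wp (While (NLt (NConst 0) (nvar nWalk)) climb) s Q.
Proof.
move=> ld wi hk stop.
pose I m t s1 := t = 0%N /\ exists j : node N,
  [/\ m = depth j, nmem s1 nWalk 0%N = j
    & (depth j + nmem s1 nHeight 0 = depth i + k)%N].
apply: (@wp_while _ _ _ I _ _ _ _ (depth i)).
- move=> m t s1 fr [-> [j [_ wj hj]]]; rewrite /= wj -leqNgt leqn0 => j0.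
  apply: stop => //; rewrite -hj.
  by move: j0; rewrite -[_ == _]/(j == ord0) -depth_eq0 => /eqP ->.
- move=> m t s1 fr [-> [j [-> wj hj]]]; rewrite /= wj lt0n => j0.
  have {}j0 : j != ord0 by [].
  rewrite lt0n depth_eq0; split=> //; split=> //; exists (parent j); split.
  + by rewrite depth_parent.
  + rewrite /update /= wj; apply: loaded_parent.
    exact: loaded_frame ld fr.
  + by rewrite /update /= addn1 addnS -addSn -depth_parent.
- by split=> //; exists i; rewrite wi hk.
Qed.

Lemma wp_push s i (P : {set node N}) a :
    loaded s -> rmem s rZero 0%N = 0 -> nmem s nNode 0%N = i ->
    i != ord0 -> i \notin P -> child i \subset P ->
    tracks a P (row s rPre) (row s rSlope) ->
  wp push s (fun t s1 => (t <= 3)%N /\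
    tracks a (i |: P) (row s1 rPre) (row s1 rSlope)).
Proof.
move=> ld zero ni i0 iP iC acc; have := tracks_push i0 iP iC acc.
rewrite /push /= /rget /= zero ni (loaded_parent i ld) /row.
case: ifP => _ acc'; split=> //; apply: tracks_ext acc' => j;
  rewrite /rset /rget /update /= ni (loaded_parent i ld);
  by have [->|ji] := eqVneq j (parent i);
    rewrite ?eqxx // (negbTE (ji : (j != parent i :> nat))).
Qed.

(** Time is charged to finished nodes only: one comparison and two additions per push. Visits to
    nodes of other levels are free, which keeps the total linear despite quadratically many
    visits. *)
Definition visited a k m t s : Prop :=
  (t <= 3 * #|finished N k m|)%N /\
  tracks a (finished N k m) (row s rPre) (row s rSlope).

Lemma wp_visit_node s a k i t : (k < nnodes N)%N ->
    loaded s -> rmem s rZero 0%N = 0 ->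
    nmem s nNode 0%N = i -> nmem s nLevel 0%N = k -> visited a k i t s ->
  wp visit_node s (fun t1 s1 =>
    nmem s1 nNode 0%N = i.+1 /\ visited a k i.+1 (t + t1) s1).
Proof.
move=> kn ld zero ni lk [tP acc].
rewrite /visit_node /seqs /=; set s0 := nset _ _ _ _.
have ld0 : loaded s0 by do 2 apply: loaded_nset => //.
apply: (wp_climb (i := i) (k := k) ld0).
- by rewrite /s0 /update /= ni.
- by rewrite /s0 /update /= lk.
move=> s1 fr hk; have ld1 := loaded_frame (isT : keeps_input climb) ld0 fr.
have zero1 : rmem s1 rZero 0%N = 0 by case: fr => _ ->.
have ni1 : nmem s1 nNode 0%N = i by case: fr => ->.
have acc1 : tracks a (finished N k i) (row s1 rPre) (row s1 rSlope).
  by case: fr => _ rf; rewrite /row !rf.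
change (wp (Seq (If (NLt (nvar nHeight) (nvar nSize)) Skip
      (If (NLt (nvar nSize) (nvar nHeight)) Skip push)) (Seq (incr nNode) Skip)) s1
  (fun t1 s2 => nmem s2 nNode 0%N = i.+1 /\ visited a k i.+1 (t + t1) s2)).
apply: wp_seq.
have fin t1 s2 : frame push s1 s2 -> (t + t1 <= 3 * #|finished N k i.+1|)%N ->
    tracks a (finished N k i.+1) (row s2 rPre) (row s2 rSlope) ->
  wp (Seq (incr nNode) Skip) s2 (fun t2 s3 => nmem s3 nNode 0%N = i.+1 /\
    visited a k i.+1 (t + (t1 + t2)) s3).
  move=> [nf _] t1P acc2; rewrite /= /visited /= !addn0; split; last by [].
  by rewrite /update /= nf // ni1 addn1.
have skip : (depth i + k != nnodes N)%N ->
    wp (Seq (incr nNode) Skip) s1 (fun t2 s3 => nmem s3 nNode 0%N = i.+1 /\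
    visited a k i.+1 (t + (0 + t2)) s3).
  by move=> ik; apply: fin; rewrite ?finished_skip ?addn0.
rewrite /= hk; case: ltnP => [hn|hn].
  by rewrite /= (loaded_size ld1) in hn; apply: skip; rewrite neq_ltn hn.
rewrite (loaded_size ld1) in hn *; case: ltnP => [nh|nh].
  by apply: skip; rewrite neq_ltn nh orbT.
have ik : (depth i + k = nnodes N)%N by apply/eqP; rewrite eqn_leq nh hn.
(* The root has depth 0 and would need level [nnodes N], but [k] stays below it. *)
have i0 : i != ord0.
  by rewrite -depth_eq0; apply: contraTneq kn => d0; rewrite -ik d0 ltnn.
change (wp push s1 (fun t1 s2 => wp (Seq (incr nNode) Skip) s2
  (fun t2 s3 => nmem s3 nNode 0%N = i.+1 /\ visited a k i.+1 (t + (t1 + t2)) s3))).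
apply: wp_frame (wp_push ld1 zero1 ni1 i0 (finished_notin ik) (child_finished ik) acc1) _.
move=> t1 s2 fr2 [t1P acc2]; apply: fin; rewrite ?finished_step //.
by rewrite cardsU1 finished_notin // mulnDr addnC leq_add.
Qed.

Lemma wp_visit_level s a k t : (0 < k < nnodes N)%N ->
    loaded s -> rmem s rZero 0%N = 0 -> nmem s nLevel 0%N = k ->
    visited a k 0 t s ->
  wp visit_level s (fun t1 s1 =>
    nmem s1 nLevel 0%N = k.+1 /\ visited a k.+1 0 (t + t1) s1).
Proof.
move=> /andP[k0 kn] ld zero lk vis.
pose s0 := nset s nNode 0 0.
have ld0 : loaded s0 by apply: loaded_nset.
change (wp (Seq (While (NLt (nvar nNode) (nvar nSize)) visit_node)
    (Seq (incr nLevel) Skip)) s0 (fun t1 s1 =>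
  nmem s1 nLevel 0%N = k.+1 /\ visited a k.+1 0 (t + t1) s1)).
apply: wp_seq; apply: (@wp_count R nNode visit_node (nnodes N)
  (fun m t1 => visited a k m (t + t1)) _ s0 0%N) => //=.
- exact: (loaded_size ld).
- by rewrite addn0.
- move=> i t1 s1 lt fr ni vis1.
  have := @wp_visit_node s1 a k (Ordinal lt) (t + t1)%N.
  rewrite -[nat_of_ord _]/i; under [X in wp _ _ X]eq_fun do under eq_fun do rewrite -addnA.
  apply=> //; first exact: (loaded_frame (isT : keeps_input visit_node) ld0 fr).
    by case: fr => _ ->.
  by case: fr => ->.
- move=> t1 s1 [nf _]; rewrite /visited finished_next add0n !addn0 => vis1; split=> //.
  by rewrite /update /= nf // /s0 /= /update /= lk addn1.
Qed.

(** Before any push the arguments are affine with slope [- cost j]. Each node takes one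
    multiplication and two subtractions. *)
Lemma wp_init s a :
    loaded s -> rmem s rMid 0%N = a -> rmem s rZero 0%N = 0 ->
    nmem s nNode 0%N = 0%N ->
  wp (While (NLt (nvar nNode) (nvar nSize)) init_node) s
    (fun t s1 => t = (3 * nnodes N)%N /\
       tracks a finset.set0 (row s1 rPre) (row s1 rSlope)).
Proof.
move=> ld mid zero n0.
apply: (@wp_count R nNode init_node (nnodes N) (fun m t s1 => t = (3 * m)%N /\
  forall j, (j < m)%N -> rmem s1 rPre j = (weight j)%:R - cost j * a /\
    rmem s1 rSlope j = - cost j) _ s 0%N) => //.
- exact: loaded_size.
- move=> i t s1 lt fr ni [-> IH]; pose i' := Ordinal lt.
  have ld1 : loaded s1 by exact: loaded_frame ld fr.
  have zero1 : rmem s1 rZero 0%N = 0 by case: fr => _ ->.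
  have mid1 : rmem s1 rMid 0%N = a by case: fr => _ ->.
  rewrite /init_node /= /rget /update /= ni addn1; split=> //; split; first by rewrite mulnSr.
  move=> j; rewrite ltnS leq_eqVlt => /orP[/eqP ji|ji].
    rewrite ji eqxx /= mid1 zero1 -ji (loaded_weight j ld1) (loaded_cost j ld1).
    by rewrite sub0r.
  by rewrite (ltn_eqF ji); apply: IH.
- move=> t s1 _ [-> IH]; split=> //; apply: tracks0 => j; rewrite /row;
  by case: (IH j (ltn_ord j)).
Qed.

Lemma wp_verdict s a :
    loaded s -> rmem s rZero 0%N = 0 ->
    tracks a [set~ ord0] (row s rPre) (row s rSlope) ->
  wp verdict s (fun t s1 => (t <= 3)%N /\ exists g : R,
    (forall b, z N a + g * (b - a) <= z N b) /\ (0 < nmem s1 nAnswer 0)%N = (0 <= g)).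
Proof.
move=> ld zero acc.
have sub : child ord0 \subset [set~ ord0 : node N].
  by apply/fintype.subsetP => j; rewrite !inE => /andP[].
have := lambda_subgradient sub acc; set g := (if _ then _ else _) => gP.
have zsub b : z N a + (budget N + g) * (b - a) <= z N b.
  by have := gP b; rewrite /z; lra.
rewrite /verdict /= /rget /= /update /= zero (loaded_budget ld).
rewrite (_ : rmem s rPre 0%N = row s rPre ord0) //.
(* Whether or not the root is active, the value tested is [budget N + g], so both branches end
   alike. *)
suff fin (t : nat) (x : R) : (t <= 3)%N -> x = budget N + g ->
  if x < 0 then (t <= 3)%N /\ exists g' : R,
      (forall b, z N a + g' * (b - a) <= z N b) /\
      (0 < 0)%N = (0 <= g')
  else (t <= 3)%N /\ exists g' : R,
      (forall b, z N a + g' * (b - a) <= z N b) /\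
      (0 < 1)%N = (0 <= g').
  by case: ifPn => pos; apply: fin => //; rewrite /g ?pos ?(negbTE pos) ?addr0.
move=> t3 ->; have [neg|pos] := ltP (budget N + g) 0; split=> //;
  exists (budget N + g); split=> //.
by rewrite leNgt neg.
Qed.

(** Initialization takes [3n] operations, the pushes at most [3n] and the verdict at most 3; the sum
    is below [9n] because [n >= 1]. *)
Lemma wp_slope_sign s a : loaded s -> rmem s rMid 0%N = a ->
  wp slope_sign s (fun t s1 => (t <= 9 * nnodes N)%N /\ exists g : R,
    (forall b, z N a + g * (b - a) <= z N b) /\ (0 < nmem s1 nAnswer 0)%N = (0 <= g)).
Proof.
move=> ld mid; set Q := (X in wp _ _ X).
pose s0 := nset (rset s (rvar rZero) 0) nNode 0 0.
have ld0 : loaded s0 by apply: loaded_nset => //; apply: loaded_rset.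
change (wp (Seq (While (NLt (nvar nNode) (nvar nSize)) init_node)
  (Seq (NSet nLevel (NConst 0) (NConst 1))
  (Seq (While (NLt (nvar nLevel) (nvar nSize)) visit_level)
  (Seq verdict Skip)))) s0 Q).
apply/wp_seq/(wp_frame (wp_init (a := a) ld0 _ _ _)) => // t1 s1 fr1 [-> acc1].
have ld1 : loaded s1 by exact: (loaded_frame (isT : keeps_input init_node) ld0 fr1).
pose s2 := nset s1 nLevel 0 1.
have ld2 : loaded s2 by apply: loaded_nset.
change (wp (Seq (While (NLt (nvar nLevel) (nvar nSize)) visit_level)
  (Seq verdict Skip)) s2 (fun t => Q (3 * nnodes N + t)%N)).
apply/wp_seq/(@wp_count R nLevel visit_level (nnodes N)
  (fun k t s3 => (0 < k)%N /\ visited a k 0 t s3) _ s2 1%N) => //.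
- exact: loaded_size ld2.
- by rewrite /visited finished_first.
- move=> k t s3 kn fr lk [k0 vis].
  suff: wp visit_level s3 (fun t4 s4 => nmem s4 nLevel 0%N = k.+1 /\
      visited a k.+1 0 (t + t4) s4) by apply: wp_exec_mono => t4 s4 _ [].
  apply: wp_visit_level => //; first by rewrite k0.
  + exact: (loaded_frame (isT : keeps_input visit_level) ld2 fr).
  + by case: fr => _ -> //; rewrite /s2 /=; case: fr1 => _ ->.
- move=> t s3 fr [_ [tP acc]].
  have zero3 : rmem s3 rZero 0%N = 0 by case: fr => _ -> //; rewrite /s2 /=; case: fr1 => _ ->.
  have ld3 := loaded_frame (isT : keeps_input visit_level) ld2 fr.
  rewrite finished_last in tP acc.
  apply/wp_seq/(wp_frame (wp_verdict ld3 zero3 acc)) => t4 s4 _ [t4P gP].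
  rewrite /= /Q; split=> //; have {}tP : (t <= 3 * nnodes N)%N.
    apply: leq_trans tP _; rewrite leq_mul2l /=.
    by rewrite -[leqRHS](card_ord (npred N).+1) max_card.
  by have : (0 < nnodes N)%N by []; lia.
Qed.

End SlopeSign.

(** * Bisection *)

Section Bisection.
Variables (R : realType) (N : network R) (eps : R).
Implicit Types (s : state R) (i j : node N).

Let ratio := RCalc (rvar rTmp) RDiv (rW, nvar nCount) (rC, nvar nCount).
Let width := RCalc (rvar rWidth) RSub (rvar rHi) (rvar rLo).

Definition endpoints_step : cmd :=
  seqs [::
    ratio;
    If (RLt (rvar rTmp) (rvar rLo)) (RCopy (rvar rLo) (rvar rTmp)) Skip;
    If (RLt (rvar rHi) (rvar rTmp)) (RCopy (rvar rHi) (rvar rTmp)) Skip;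
    incr nCount].

(** Bounds from both sides suffice: after the last node they squeeze the endpoints to [rho_min] and
    [rho_max]. *)
Definition brackets (m : nat) s : Prop :=
  [/\ rho_min N <= rmem s rLo 0%N, rmem s rHi 0%N <= rho_max N
    & forall j, (j < m)%N -> rmem s rLo 0%N <= rho j <= rmem s rHi 0%N].

Lemma wp_endpoints_step s i (t : nat) : loaded N eps s ->
    nmem s nCount 0%N = i -> brackets i s ->
  wp endpoints_step s (fun t1 s1 =>
    nmem s1 nCount 0%N = i.+1 /\ t1 = 3 /\ brackets i.+1 s1).
Proof.
move=> ld ni [mlo hiM IH].
rewrite /endpoints_step /ratio /= /rget /update /= ni.
rewrite (loaded_weight i ld) (loaded_cost i ld) -/(rho i).
(* The two conditionals compute a minimum and a maximum, so one claim serves all four branches. *)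
have upd (lo hi lo' hi' : R) : lo' = Num.min lo (rho i) -> hi' = Num.max hi (rho i) ->
    rho_min N <= lo -> hi <= rho_max N ->
    (forall j, (j < i)%N -> lo <= rho j <= hi) ->
  [/\ rho_min N <= lo', hi' <= rho_max N
    & forall j, (j < i.+1)%N -> lo' <= rho j <= hi'].
  move=> -> -> mlo' hiM' IH'; split.
  - by rewrite le_min mlo' rho_min_le.
  - by rewrite ge_max hiM' rho_max_ge.
  - move=> j; rewrite ltnS leq_eqVlt => /orP[/eqP/val_inj ->|/IH'/andP[l h]].
      by rewrite ge_min le_max lexx !orbT.
    by rewrite ge_min le_max l h.
case: ltP => lo1; case: ltP => hi1; (split; first by rewrite addn1); split=> //;
  apply: upd mlo hiM IH; apply/esym;
  by [apply/min_idPr/ltW|apply/min_idPl|apply/max_idPr/ltW|apply/max_idPl].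
Qed.

Lemma wp_endpoints : wp endpoints (input N eps) (fun t s =>
  [/\ t = (3 * nnodes N + 1)%N, loaded N eps s,
      rmem s rLo 0%N = rho_min N & rmem s rHi 0%N = rho_max N]).
Proof.
set Q := (X in wp _ _ X).
pose s1 := nset (input N eps) nCount 0 0.
have ld1 : loaded N eps s1 by apply: loaded_nset.
pose r0 := rget s1 (rW, nvar nCount) / rget s1 (rC, nvar nCount).
have r0E : r0 = rho (ord0 : node N).
  by rewrite /rho -(loaded_weight ord0 ld1) -(loaded_cost ord0 ld1).
pose s2 := rset s1 (rvar rTmp) r0.
pose s3 := rset s2 (rvar rLo) (rget s2 (rvar rTmp)).
pose s4 := rset s3 (rvar rHi) (rget s3 (rvar rTmp)).
have ld4 : loaded N eps s4 by do 3 apply: loaded_rset => //.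
change (wp (Seq (While (NLt (nvar nCount) (nvar nSize)) endpoints_step) Skip) s4
  (fun t => Q (1 + t)%N)).
apply/wp_seq/(@wp_count R nCount endpoints_step (nnodes N)
  (fun m t s => t = (3 * m)%N /\ brackets m s) _ s4 0%N) => //.
- split=> //; split=> //.
    by rewrite /s4 /s3 /s2 /rget /= /update /= r0E rho_min_le.
  by rewrite /s4 /s3 /s2 /rget /= /update /= r0E rho_max_ge.
- move=> m t s lt fr cm [-> br].
  have ld := loaded_frame (isT : keeps_input endpoints_step) ld4 fr.
  have := @wp_endpoints_step s (Ordinal lt) (3 * m) ld cm br.
  by apply: wp_exec_mono => t1 s5 _ [-> [-> br1]]; rewrite mulnSr.
- move=> t s fr [-> [mlo hiM br]]; have br' j := br j (ltn_ord j).
  rewrite /= /Q; split.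
  + by rewrite addn0 addnC.
  + exact: (loaded_frame (isT : keeps_input endpoints_step) ld4 fr).
  + apply/eqP; rewrite eq_le mlo andbT; apply: le_bigmin => [|j _];
      by [case/andP: (br' ord0)|case/andP: (br' j)].
  + apply/eqP; rewrite eq_le hiM /=; apply: bigmax_le => [|j _];
      by [case/andP: (br' ord0)|case/andP: (br' j)].
Qed.

Variable side : cmd.

Definition bisection_step : cmd :=
  seqs [::
    RCalc (rvar rMid) RAdd (rvar rLo) (rvar rHi);
    RConst (rvar rTmp) 2;
    RCalc (rvar rMid) RDiv (rvar rMid) (rvar rTmp);
    side;
    If (NLt (NConst 0) (nvar nAnswer))
      (RCopy (rvar rHi) (rvar rMid)) (RCopy (rvar rLo) (rvar rMid));
    width].

(** The outer bounds keep each midpoint nonnegative, as [optimal_halving] requires, and later place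
    the output in the search interval. *)
Definition localized s : Prop :=
  [/\ rho_min N <= rmem s rLo 0%N, rmem s rHi 0%N <= rho_max N
    & exists a, optimal N a /\ rmem s rLo 0%N <= a <= rmem s rHi 0%N].

Hypotheses (side_admissible : admissible side) (side_keeps : keeps_input side).
Variable T : nat.
Hypothesis wp_side : forall s a, loaded N eps s -> rmem s rMid 0%N = a ->
  wp side s (fun t s1 => (t <= T)%N /\ exists g : R,
    (forall b, z N a + g * (b - a) <= z N b) /\
    (0 < nmem s1 nAnswer 0)%N = (0 <= g)).

Lemma wp_bisection_step s : loaded N eps s -> localized s ->
  wp bisection_step s (fun t s1 => [/\ (t <= T + 3)%N, localized s1,
    rmem s1 rWidth 0%N = (rmem s rHi 0%N - rmem s rLo 0%N) / 2
    & rmem s1 rHi 0%N - rmem s1 rLo 0%N = rmem s1 rWidth 0%N]).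
Proof.
move=> ld [mlo hiM [a [aopt /andP[loa ahi]]]].
set lo := rmem s rLo 0%N in mlo loa *; set hi := rmem s rHi 0%N in hiM ahi *.
set Q := (X in wp _ _ X).
pose mid := (lo + hi) / 2.
pose s1 := rset (rset (rset s (rvar rMid) (lo + hi)) (rvar rTmp) 2) (rvar rMid) mid.
have ld1 : loaded N eps s1 by do 3 apply: loaded_rset => //.
have le_mid : lo <= mid <= hi by rewrite /mid; apply/andP; split; lra.
have [lomid midhi] := andP le_mid.
change (wp side s1 (fun t s2 => wp (seqs [:: If (NLt (NConst 0) (nvar nAnswer))
      (RCopy (rvar rHi) (rvar rMid)) (RCopy (rvar rLo) (rvar rMid)); width]) s2
  (fun t1 => Q (1 + (0 + (1 + (t + t1))))%N))).
have mid0 : 0 <= mid by rewrite (le_trans (rho_min_ge0 N)) // (le_trans mlo).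
apply: wp_frame (wp_side ld1 (erefl : rmem s1 rMid 0%N = mid)) _.
move=> t s2 [_ rf] [tT [g [sub ans]]].
(* Admissibility of [side] preserves the interval and the query point. *)
have [lo2 hi2 mid2] : [/\ rmem s2 rLo 0%N = lo, rmem s2 rHi 0%N = hi
    & rmem s2 rMid 0%N = mid].
  by split; rewrite rf //; apply: side_admissible.
have [|c [copt cin]] := optimal_halving mid0 sub _ le_mid.
  by exists a; rewrite loa ahi.
rewrite /= ans; case: ifP cin => _ cin;
  rewrite /Q /localized /rget /= /update /= ?lo2 ?hi2 ?mid2.
all: by split=> //; [lia|split=> //; [lra|exists c]|rewrite /mid; lra].
Qed.

(** A round costs [T + 3] operations and one loop test. Outside the rounds there are [3n + 1]
    operations for the endpoints, one for the first width and the final failing test. *)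
Lemma wp_bisection (K : nat) : 0 < eps -> ell N < eps * 2 ^+ K ->
  wp (bisection side) (input N eps) (fun t s =>
    [/\ (t <= 3 * nnodes N + 3 + K * (T + 4))%N, localized s
      & rmem s rHi 0%N - rmem s rLo 0%N <= eps]).
Proof.
move=> eps0 K_large; set Q := (X in wp _ _ X).
apply/wp_seq/(wp_exec_mono _ wp_endpoints) => t0 s0 _ [-> ld0 lo0 hi0].
pose s1 := rset s0 (rvar rWidth) (rmem s0 rHi 0%N - rmem s0 rLo 0%N).
have ld1 : loaded N eps s1 by apply: loaded_rset.
change (wp (Seq (While (RLt (rvar rEps) (rvar rWidth)) bisection_step) Skip) s1
  (fun t => Q (3 * nnodes N + 1 + (1 + t))%N)).
pose I m t s := [/\ (t + m * (T + 4) <= K * (T + 4))%N, localized s,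
  rmem s rHi 0%N - rmem s rLo 0%N = rmem s rWidth 0%N
  & rmem s rWidth 0%N < eps * 2 ^+ m].
have keeps : keeps_input bisection_step.
  move: side_keeps.
  by rewrite /keeps_input /= !inE !mem_cat !inE /= !orbF.
apply/wp_seq/(@wp_while R _ _ I _ s1 _ _ K).
- move=> m t s fr [tm loc wd wm]; have ld := loaded_frame keeps ld1 fr.
  rewrite /= /rget (loaded_eps ld) -leNgt => stop.
  rewrite /Q; split=> //; last by rewrite wd.
  lia.
- move=> m t s fr [tm loc wd wm]; have ld := loaded_frame keeps ld1 fr.
  (* With no rounds left, the invariant says that the width is below [eps], against the loop
     test. *)
  rewrite [test_eval _ _]/= /rget [neval _ _]/= (loaded_eps ld) => go; have m0 : (0 < m)%N.
    by case: m {tm} wm => // wm; lra.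
  split=> //; apply: wp_exec_mono (wp_bisection_step ld loc) => t1 s2 _.
  case=> t1T loc2 wd2 wd2'; split=> //.
    by case: m m0 tm {wm} => //= m _; rewrite mulSn; lia.
  case: m m0 wm {tm} => // m _; rewrite exprS wd2 wd /=; lra.
- split.
  + lia.
  + have [a [aopt aI]] := optimal_exists N.
    by split; rewrite /= /update /= ?lo0 ?hi0 //; exists a.
  + by [].
  + by rewrite /= /update /= lo0 hi0.
Qed.

End Bisection.

(** * The number of halvings and the total running time *)

(** The witness is the integer part of the binary logarithm of [x], plus one. *)
Lemma halvings_exist (R : realType) (x : R) : 1 < x ->
  exists K : nat, x < 2 ^+ K /\ K%:R <= ln x / ln 2 + 1.
Proof.
move=> x1; have x0 : 0 < x by apply: lt_trans x1.
have ln2 : 0 < ln (2 : R) by apply: ln_gt0; lra.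
have lnx : 0 < ln x by apply: ln_gt0.
exists (Num.truncn (ln x / ln 2)).+1; split.
  rewrite -ltr_ln ?posrE ?exprn_gt0 // lnXn // -[ln 2 *+ _]mulr_natl -ltr_pdivrMr //.
  exact: truncnS_gt.
by rewrite -natr1 lerD2r truncn_le // divr_ge0 ?ltW.
Qed.

Theorem mainTheorem9 (R : realType) :
  (forall N : network R,
     exists a : R, optimal N a /\ rho_min N <= a <= rho_max N) /\
  (exists (side : cmd) (C : R), admissible side /\
     forall (N : network R) (eps : R), 0 < eps -> eps < ell N ->
       exists (t : nat) (s : state R),
         [/\ exec (bisection side) (input N eps) t s,
             rho_min N <= output s <= rho_max N,
             exists a : R, optimal N a /\ `|output s - a| <= eps
           & t%:R <= C * (nnodes N)%:R * Num.max 1 (ln (ell N / eps))]).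
Proof.
split=> [N|]; first exact: optimal_exists.
have adm : admissible slope_sign by apply/allP.
(* With [T = 9n], the time [3n + 3 + K * (9n + 4)] is at most [n * (6 + 13 K)]. Inserting
   [K <= L / ln 2 + 1], where [L] is the logarithm of [ell N / eps], yields
   [n * (19 + 13 L / ln 2)]. *)
exists slope_sign, (19 + 13 / ln 2); split=> // N eps eps0 eps_ell.
have x1 : 1 < ell N / eps by rewrite ltr_pdivlMr ?mul1r.
have [K [Kx KL]] := halvings_exist x1.
rewrite ltr_pdivrMr // mulrC in Kx.
have := wp_bisection adm isT (@wp_slope_sign R N eps) eps0 Kx.
case/wp_exec => t [s [ex [tK [lo_ge hi_le [a [aopt /andP[loa ahi]]]] small]]].
exists t, s; rewrite /output /rget /=; split=> //.
- by rewrite lo_ge /=; lra.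
(* The output is the left end of an interval of length at most [eps] that contains [a]. *)
- by exists a; split=> //; rewrite ler_norml; lra.
(* [M] dominates both 1 and [L], so it absorbs the constant term 19 even when [L] is close to 0. *)
set L := ln _ in KL *; set M := Num.max 1 L.
have M1 : 1 <= M by rewrite le_max lexx.
have LM : L <= M by rewrite le_max lexx orbT.
have ln2 : 0 < (ln (2 : R))^-1 by rewrite invr_gt0 ln_gt0 //; lra.
have tn : (t <= nnodes N * (6 + 13 * K))%N.
  by apply: leq_trans tK _; have : (0 < nnodes N)%N by []; nia.
apply: (@le_trans _ _ ((nnodes N)%:R * (6 + 13 * K%:R))).
  by rewrite -natrM -natrD -natrM ler_nat.
rewrite [_ * (nnodes N)%:R]mulrC -mulrA ler_wpM2l ?ler0n //.
by nra.
Qed.
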